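(* Let $k$ be a non-negative integer and $l$ a positive integer, and let $Q_{k,l}(m,n)=(m+n)l+k\frac{n(n-1)}{2}+(n-1)mk+(k+1)\frac{m(m+1)}{2}$. Then, as formal power series in $x,q$, \[ \sum_{j\geq 0}\frac{x^jq^{lj+kj(j-1)/2}}{(q;q)_j}=\sum_{m,n\geq 0}\frac{x^{m+n}q^{Q_{k,l}(m,n)}}{(q;q)_m(q^2;q^2)_{\lfloor n/2\rfloor}}. \]
   Context: $(a;q)_j=\prod_{i=0}^{j-1}(1-aq^i)$; $\lfloor\cdot\rfloor$ is the floor function. *)

(* Defs.v *)
From HB Require Import structures.
From mathcomp Require Import all_boot all_order all_algebra.
From mathcomp Require Import boolp classical_sets cardinality fsbigop.
From mathcomp Require Import zify.

Set Implicit Arguments.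
Unset Strict Implicit.
Unset Printing Implicit Defensive.
Import Order.TTheory GRing.Theory Num.Theory.

Local Open Scope ring_scope.

(* R[[t]]: the formal power series \sum_n (f n) t^n is represented by its
   coefficient sequence. *)
Record fps (R : Type) := Fps { fps_coef : nat -> R }.

HB.instance Definition _ (R : Type) := gen_eqMixin (fps R).
HB.instance Definition _ (R : Type) := gen_choiceMixin (fps R).

Lemma fpsP (R : Type) (f g : fps R) :
  (forall n, fps_coef f n = fps_coef g n) -> f = g.
Proof. by case: f g => [f] [g] /= fg; congr Fps; apply/funext. Qed.

Section FpsRing.
Variable R : comNzRingType.
Implicit Types f g h : fps R.

Definition fps_zero : fps R := Fps (fun=> 0).
Definition fps_opp f : fps R := Fps (fun n => - fps_coef f n).
Definition fps_add f g : fps R := Fps (fun n => fps_coef f n + fps_coef g n).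

Fact fps_addA : associative fps_add.
Proof. by move=> f g h; apply: fpsP => n /=; rewrite addrA. Qed.
Fact fps_addC : commutative fps_add.
Proof. by move=> f g; apply: fpsP => n /=; rewrite addrC. Qed.
Fact fps_add0 : left_id fps_zero fps_add.
Proof. by move=> f; apply: fpsP => n /=; rewrite add0r. Qed.
Fact fps_addN : left_inverse fps_zero fps_opp fps_add.
Proof. by move=> f; apply: fpsP => n /=; rewrite addNr. Qed.

HB.instance Definition _ :=
  GRing.isZmodule.Build (fps R) fps_addA fps_addC fps_add0 fps_addN.

Definition fpsC (c : R) : fps R := Fps (fun n => if n == 0%N then c else 0).
Definition fps_mul f g : fps R :=
  Fps (fun n => \sum_(i < n.+1) fps_coef f i * fps_coef g (n - i)).

Definition fps_trunc N f : {poly R} := \poly_(i < N) fps_coef f i.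

Fact fps_mul_trunc N f g n : (n < N)%N ->
  fps_coef (fps_mul f g) n = (fps_trunc N f * fps_trunc N g)`_n.
Proof.
move=> nN; rewrite coefM /=; apply: eq_bigr => i _; rewrite !coef_poly.
by rewrite (leq_ltn_trans (leq_ord i) nN) (leq_ltn_trans (leq_subr i n) nN).
Qed.

Fact fps_mulC : commutative fps_mul.
Proof.
by move=> f g; apply: fpsP => n; rewrite !(fps_mul_trunc _ _ (ltnSn n)) mulrC.
Qed.

Fact fps_mulA : associative fps_mul.
Proof.
move=> f g h; apply: fpsP => n.
pose t := fps_trunc n.+1.
transitivity ((t f * t g * t h)`_n).
  rewrite -mulrA coefM; apply: eq_bigr => i _ /=.
  rewrite coef_poly ltn_ord; congr (_ * _).
  by rewrite -(@fps_mul_trunc n.+1) // ltnS leq_subr.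
rewrite coefM; apply: eq_bigr => i _ /=.
rewrite coef_poly ltnS leq_subr; congr (_ * _).
by rewrite -(@fps_mul_trunc n.+1).
Qed.

Fact fps_mul1 : left_id (fpsC 1) fps_mul.
Proof.
move=> f; apply: fpsP => n /=.
by rewrite big_ord_recl /= mul1r subn0 big1 ?addr0 // => i _; rewrite mul0r.
Qed.

Fact fps_mulDl : left_distributive fps_mul fps_add.
Proof.
move=> f g h; apply: fpsP => n /=; rewrite -big_split /=.
by apply: eq_bigr => i _; rewrite mulrDl.
Qed.

Fact fps_1neq0 : fpsC 1 != 0.
Proof.
by apply/eqP => /(congr1 (fun f => fps_coef f 0)) /= /eqP; rewrite oner_eq0.
Qed.

HB.instance Definition _ := GRing.Zmodule_isComNzRing.Build (fps R)
  fps_mulA fps_mulC fps_mul1 fps_mulDl fps_1neq0.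

Definition fpsX : fps R := Fps (fun n => if n == 1%N then 1 else 0).

Lemma fps_coef0 n : fps_coef (0 : fps R) n = 0.
Proof. by []. Qed.
Lemma fps_coef1 n : fps_coef (1 : fps R) n = if n == 0%N then 1 else 0.
Proof. by []. Qed.
Lemma fps_coefD f g n : fps_coef (f + g) n = fps_coef f n + fps_coef g n.
Proof. by []. Qed.
Lemma fps_coefN f n : fps_coef (- f) n = - fps_coef f n.
Proof. by []. Qed.
Lemma fps_coefM f g n :
  fps_coef (f * g) n = \sum_(i < n.+1) fps_coef f i * fps_coef g (n - i).
Proof. by []. Qed.

End FpsRing.

Arguments fpsX {R}.

Section FpsUnit.
Variable R : comUnitRingType.
Implicit Types f g : fps R.

(* The first n coefficients of 1/f, from f_0 g_0 = 1 and
   \sum_(i <= n) f_(n-i) g_i = 0 for n > 0. *)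
Fixpoint fps_inv_seq f n : seq R :=
  if n is n'.+1 then
    let s := fps_inv_seq f n' in
    rcons s ((fps_coef f 0)^-1 *
      ((n' == 0)%N%:R - \sum_(i < n') fps_coef f (n' - i) * s`_i))
  else [::].

Definition fps_unit : pred (fps R) := fun f => fps_coef f 0 \is a GRing.unit.
Definition fps_inv f : fps R :=
  if fps_unit f then Fps (fun n => (fps_inv_seq f n.+1)`_n) else f.

Fact size_fps_inv_seq f n : size (fps_inv_seq f n) = n.
Proof. by elim: n => //= n IHn; rewrite size_rcons IHn. Qed.

Fact nth_fps_inv_seq f n i : (i < n)%N ->
  (fps_inv_seq f n)`_i = (fps_inv_seq f i.+1)`_i.
Proof.
elim: n => // n IHn; rewrite ltnS leq_eqVlt => /orP[/eqP-> //|lt_in].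
by rewrite [LHS]/= nth_rcons size_fps_inv_seq lt_in IHn.
Qed.

Fact fps_mulVr : {in fps_unit, left_inverse 1 fps_inv *%R}.
Proof.
move=> f fU; rewrite /fps_inv; have -> : fps_unit f by [].
apply: fpsP => n; rewrite fps_coefM big_ord_recr /= subnn.
rewrite nth_rcons size_fps_inv_seq ltnn eqxx mulrC mulrA divrr // mul1r.
under eq_bigr => i _ do
  rewrite -[rcons _ _]/(fps_inv_seq f i.+1) -(nth_fps_inv_seq _ (ltn_ord i)) mulrC.
by rewrite addrC subrK; case: (n == 0%N).
Qed.

Fact fps_unitPl f g : g * f = 1 -> fps_unit f.
Proof.
move=> /(congr1 (fun h => fps_coef h 0)); rewrite fps_coefM big_ord1 subn0.
by move=> gf1; apply/unitrPr; exists (fps_coef g 0); rewrite mulrC.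
Qed.

Fact fps_inv_out : {in [predC fps_unit], fps_inv =1 id}.
Proof. by move=> f /negbTE fU; rewrite /fps_inv [fps_unit f]fU. Qed.

HB.instance Definition _ := GRing.ComNzRing_hasMulInverse.Build (fps R)
  fps_mulVr fps_unitPl fps_inv_out.

Lemma fps_unitE f : (f \is a GRing.unit) = (fps_coef f 0 \is a GRing.unit).
Proof. by []. Qed.

End FpsUnit.

(* R[[x,q]] is taken to be R[[q]][[x]]. *)
Notation fps2 R := (fps (fps R)).
Definition xvar {R : comUnitRingType} : fps2 R := fpsX.
Definition qvar {R : comUnitRingType} : fps2 R := fpsC fpsX.

(* The coefficient of x^i q^j. *)
Definition fps2_coef (R : Type) (f : fps2 R) (i j : nat) : R :=
  fps_coef (fps_coef f i) j.

(* A family of formal power series is summable when every monomial x^i q^j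
   occurs in only finitely many of its members.  \sum_(a \in setT) is the sum
   of a finitely supported family and is 0 otherwise, so fps2_sum is
   meaningful for summable families only. *)
Definition fps2_summable (R : comUnitRingType) (I : choiceType)
    (F : I -> fps2 R) : Prop :=
  forall i j, finite_set [set a | fps2_coef (F a) i j != 0]%classic.

Definition fps2_sum (R : comUnitRingType) (I : choiceType)
    (F : I -> fps2 R) : fps2 R :=
  Fps (fun i => Fps (fun j =>
    \sum_(a \in [set: I]%classic) fps2_coef (F a) i j)).

Definition qpoch (A : comNzRingType) (a q : A) (n : nat) : A :=
  \prod_(i < n) (1 - a * q ^+ i).

(* Integer-valued because of the term (n-1)mk at n = 0. *)
Definition Qexp (k l m n : int) : int :=
  (m + n) * l + k * ((n * (n - 1)) %/ 2)%Z + (n - 1) * m * k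
  + (k + 1) * ((m * (m + 1)) %/ 2)%Z.

(* The next two lemmas show that no junk value of the inverse or of the integer
   power of a non-unit is involved in the terms x^a q^(Qexp k l m n) / (q;q)_m
   (q^2;q^2)_(n./2). *)
Lemma Qexp_ge0 (k l m n : nat) : 0 <= Qexp k l m n.
Proof.
have half (u v : int) : u = 2 * v -> (u %/ 2)%Z = v.
  by move=> ->; rewrite mulKz.
have tri (p : nat) : exists t : nat, (p * p.+1 = 2 * t)%N.
  exists (p * p.+1)./2; rewrite mul2n halfK.
  by rewrite oddM /= andbN subn0.
have [t Ht] := tri m; have [s Hs] := tri n.-1.
rewrite /Qexp (half (m%:Z * (m%:Z + 1)) t); last by lia.
case: n Hs => [|n] /= Hs.
  have tm : (m <= t)%N by nia.
  by rewrite (half _ 0) //; nia.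
rewrite (half _ s); last by lia.
by nia.
Qed.

Lemma qpoch_qvar_unit (R : comUnitRingType) (a b n : nat) : (0 < a)%N ->
  qpoch (qvar ^+ a) (qvar ^+ b) n \is a @GRing.unit (fps2 R).
Proof.
move=> a_gt0; rewrite /qpoch; elim/big_ind: _ => [|f g fU gU|i _].
- exact: unitr1.
- by rewrite unitrM fU gU.
rewrite !fps_unitE !(fps_coefD, fps_coefN, fps_coef1) /=.
suff q0 f : fps_coef (fps_coef (qvar ^+ a * f : fps2 R) 0) 0 = 0.
  by rewrite q0 subr0 unitr1.
case: a a_gt0 => // a _; rewrite exprS -mulrA fps_coefM big_ord1.
have -> : fps_coef (@qvar R) 0 = fpsX by [].
by rewrite [LHS]fps_coefM big_ord1 mul0r.
Qed.

(* Main.v *)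
Require Import Defs.
From mathcomp Require Import all_boot all_order all_algebra.
From mathcomp Require Import classical_sets cardinality fsbigop.
From mathcomp Require Import zify ring.

Set Implicit Arguments.
Unset Strict Implicit.
Import GRing.Theory.

Local Open Scope ring_scope.

(** The exponent satisfies
    [Qexp k l m n = l (m + n) + k C(m + n, 2) + C(m + 1, 2)], so comparing the
    coefficients of [x^N] reduces the theorem to
    [1 / (q;q)_N = \sum_(m + n = N) q^C(m+1,2) / ((q;q)_m (q^2;q^2)_(n./2))].
    With [E(z) = \sum_m q^C(m+1,2) z^m / (q;q)_m] and
    [G(z) = \sum_n z^n / (q^2;q^2)_(n./2)], the right-hand side is the
    coefficient of [z^N] in [E(z) G(z)].  Since [E(z) = (1 + q z) E(q z)] and
    [(1 - z) (1 + q z) G(z) = G(q z)], we get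
    [(1 - z) (E G)(z) = (E G)(q z)], that is,
    [(1 - q^N) (E G)_N = (E G)_(N-1)], the recurrence of [1 / (q;q)_N]. *)

Section FpsDilation.
Variable A : comUnitRingType.
Implicit Types (f g : fps A) (c : A).

(** The substitution [z -> c z], under which both functional equations are stated. *)
Definition fps_dilate c f : fps A := Fps (fun n => c ^+ n * fps_coef f n).

Lemma fps_dilateM c f g :
  fps_dilate c (f * g) = fps_dilate c f * fps_dilate c g.
Proof.
apply: fpsP => n; rewrite [LHS]/= !fps_coefM mulr_sumr.
apply: eq_bigr => i _ /=; have le_in : (i <= n)%N by rewrite -ltnS.
by rewrite -{1}(subnKC le_in) exprD mulrACA.
Qed.

Lemma fps_coef_fpsCM c f n : fps_coef (fpsC c * f) n = c * fps_coef f n.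
Proof.
rewrite fps_coefM big_ord_recl /= subn0 big1 ?addr0 // => i _.
by rewrite mul0r.
Qed.

Lemma fps_coef_fpsXM0 f : fps_coef (fpsX * f) 0 = 0.
Proof. by rewrite fps_coefM big_ord1 mul0r. Qed.

Lemma fps_coef_fpsXMS f n : fps_coef (fpsX * f) n.+1 = fps_coef f n.
Proof.
rewrite fps_coefM big_ord_recl /= mul0r add0r big_ord_recl /= mul1r subSS subn0.
by rewrite big1 ?addr0 // => i _; rewrite mul0r.
Qed.

Lemma fps_coef_fpsXnM (a : nat) f n :
  (n < a)%N -> fps_coef (fpsX ^+ a * f) n = 0.
Proof.
elim: a n => [//|a IHa] [|n] na; rewrite exprS -mulrA.
  exact: fps_coef_fpsXM0.
by rewrite fps_coef_fpsXMS IHa.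
Qed.

End FpsDilation.

Lemma qpochS (A : comNzRingType) (a q : A) n :
  qpoch a q n.+1 = qpoch a q n * (1 - a * q ^+ n).
Proof. by rewrite /qpoch big_ord_recr. Qed.

Section QIdentity.
Variables (A : comUnitRingType) (q : A).
Hypothesis qU : forall n, 1 - q ^+ n.+1 \is a GRing.unit.

Let EulerE : fps A := Fps (fun m => q ^+ 'C(m.+1, 2) / qpoch q q m).
Let EulerG : fps A := Fps (fun n => (qpoch (q ^+ 2) (q ^+ 2) n./2)^-1).

Lemma qpoch_exp_unit a n : (0 < a)%N ->
  qpoch (q ^+ a) (q ^+ a) n \is a GRing.unit.
Proof.
case: a => // a _; elim: n => [|n IHn]; first by rewrite /qpoch big_ord0 unitr1.
by rewrite qpochS unitrM IHn -exprS -exprM mulSn addSn qU.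
Qed.

(** Stated for a general base [q^a] so as to cover both [(q;q)_n] at [a = 1] and [(q^2;q^2)_n] at
    [a = 2]. *)
Lemma qpochV_rec a n : (0 < a)%N ->
  (1 - q ^+ (a * n.+1)) * (qpoch (q ^+ a) (q ^+ a) n.+1)^-1 =
  (qpoch (q ^+ a) (q ^+ a) n)^-1.
Proof.
move=> a_gt0; rewrite qpochS -exprS -exprM.
have U : 1 - q ^+ (a * n.+1) \is a GRing.unit.
  by case: a a_gt0 => // a _; rewrite mulSn addSn qU.
by rewrite invrM ?qpoch_exp_unit // mulrA divrr // mul1r.
Qed.

(** Since [C(n+2,2) = C(n+1,2) + (n+1)], the coefficients satisfy
    [(1 - q^(n+1)) E_(n+1) = q^(n+1) E_n]. *)
Lemma EulerE_dilate : EulerE = (1 + fpsC q * fpsX) * fps_dilate q EulerE.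
Proof.
apply: fpsP => n.
rewrite mulrDl mul1r -mulrA fps_coefD fps_coef_fpsCM.
case: n => [|n]; first by rewrite fps_coef_fpsXM0 mulr0 addr0 /= !mul1r.
rewrite fps_coef_fpsXMS /=.
have := qpochV_rec n (ltnSn 0); rewrite mul1n !expr1 => <-.
rewrite binS bin1 exprD.
move: (q ^+ 'C(n.+1, 2)) (_^-1) => c d; rewrite !exprS; ring.
Qed.

Lemma EulerG_dilate :
  (1 - fpsX) * (1 + fpsC q * fpsX) * EulerG = fps_dilate q EulerG.
Proof.
have -> : (1 - fpsX) * (1 + fpsC q * fpsX) * EulerG =
  EulerG - fpsX * EulerG + fpsC q * (fpsX * EulerG)
    - fpsC q * (fpsX * (fpsX * EulerG)) by ring.
apply: fpsP => n.
pose coefE := (fps_coefD, fps_coefN, fps_coef_fpsCM,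
  fps_coef_fpsXM0, fps_coef_fpsXMS).
case: n => [|[|n]]; rewrite !coefE /=; [ring|ring|].
(* In degree [n + 2] the claim is [(1 - q^(n+2)) G_(n+2) = (1 - q) G_(n+1) + q G_n]. Write
   [n = 2h + b]: for [b = 0], [G_(n+1) = G_n]; for [b = 1], [G_(n+2) = G_(n+1)]. Either way [(1 -
   q^(2h+2)) / (q^2;q^2)_(h+1) = 1 / (q^2;q^2)_h] finishes. *)
have := odd_double_half n; rewrite uphalf_half.
move: (odd n) n./2 => b h <-; have := qpochV_rec h (ltn0Sn 1); rewrite mul2n.
case: b; rewrite ?add1n ?add0n => <-;
  by move: (_^-1) => c; rewrite doubleS !exprS; ring.
Qed.

Lemma qpochV_convolution N :
  (qpoch q q N)^-1 = \sum_(m < N.+1)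
    q ^+ 'C(m.+1, 2) / (qpoch q q m * qpoch (q ^+ 2) (q ^+ 2) (N - m)./2).
Proof.
pose B := EulerE * EulerG.
have BE : (1 - fpsX) * B = fps_dilate q B.
  rewrite /B fps_dilateM -EulerG_dilate {1}EulerE_dilate; ring.
transitivity (fps_coef B N); last first.
  apply: eq_bigr => m _ /=.
  rewrite -mulrA [qpoch q q m * _]mulrC invrM ?qpoch_exp_unit //.
  by rewrite -[q]expr1 qpoch_exp_unit.
elim: N => [|N IHN].
  by rewrite fps_coefM big_ord1 /= /qpoch !big_ord0 invr1 !mulr1.
apply: (mulrI (qU N)).
have := qpochV_rec N (ltnSn 0); rewrite mul1n !expr1 => ->; rewrite IHN.
move/(congr1 (fun f => fps_coef f N.+1)): BE.
rewrite mulrBl mul1r fps_coefD fps_coefN fps_coef_fpsXMS /= => BE.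
rewrite mulrBl mul1r -BE; ring.
Qed.

End QIdentity.

Lemma Qexp_nat (k l m n : nat) :
  Qexp k l m n =
  (l * (m + n) + k * ((m + n) * (m + n - 1) %/ 2) + 'C(m.+1, 2))%N%:Z.
Proof.
have tri p : (p * (p - 1) = 2 * 'C(p, 2))%N.
  by rewrite -mul_bin_diag bin1 subn1.
(* At [p = 0] the integer [p - 1] is -1 and the natural one is 0, but both products vanish. *)
have triz (p : nat) : p%:Z * (p%:Z - 1) = 2 * 'C(p, 2)%:Z.
  by have := tri p; case: p => [|p]; nia.
have halfz (p : nat) : ((p%:Z * (p%:Z - 1)) %/ 2)%Z = 'C(p, 2)%:Z.
  by rewrite triz mulKz.
have -> : Qexp k l m n = (m + n)%:Z * l%:Z + k%:Z * 'C(n, 2)%:Z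
    + (n%:Z - 1) * m%:Z * k%:Z + (k%:Z + 1) * 'C(m.+1, 2)%:Z.
  rewrite /Qexp halfz -(halfz m.+1); congr (_ + _ * (_ %/ 2)%Z).
  by lia.
rewrite tri mulKn //.
move: (triz (m + n)%N) (triz n) (triz m.+1).
move: 'C(m + n, 2) 'C(n, 2) 'C(m.+1, 2) => s t u Hs Ht Hu.
rewrite !(PoszD, PoszM).
(* This is [C(m+n,2) = C(m,2) + m n + C(n,2)] with [C(m,2) = C(m+1,2) - m]; it merges all multiples
   of [k] into [k C(m+n,2)]. *)
have -> : u%:Z = s%:Z - t%:Z - (n%:Z - 1) * m%:Z by lia.
ring.
Qed.

(** Along [m + n = N] only the summand [C(m+1,2)] of the exponent varies; the rest factors out of
    the convolution. *)
Lemma qpochV_convolution_Qexp (A : comUnitRingType) (x q : A) (k l N : nat) :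
  (forall n, 1 - q ^+ n.+1 \is a GRing.unit) ->
  x ^+ N * q ^+ (l * N + k * (N * (N - 1) %/ 2))%N / qpoch q q N =
  \sum_(m < N.+1) x ^+ (m + (N - m)) * q ^ (Qexp k l m (N - m)%N)
    / (qpoch q q m * qpoch (q ^+ 2) (q ^+ 2) ((N - m) %/ 2)).
Proof.
move=> qU; rewrite (qpochV_convolution qU) mulr_sumr; apply: eq_bigr => m _.
have le_mN : (m <= N)%N by rewrite -ltnS.
by rewrite Qexp_nat subnKC // !divn2 -exprnP [in RHS]exprD !mulrA.
Qed.

Section Summation.
Variable R : comUnitRingType.

Lemma fps2_coef_xXnM a (f : fps2 R) i j : (i < a)%N ->
  fps2_coef (xvar ^+ a * f) i j = 0.
Proof. by move=> ia; rewrite /fps2_coef fps_coef_fpsXnM. Qed.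

Lemma fps2_coef_sum n (F : nat -> fps2 R) i j :
  fps2_coef (\sum_(m < n) F m) i j = \sum_(m < n) fps2_coef (F m) i j.
Proof.
elim: n => [|n IHn]; first by rewrite !big_ord0.
by rewrite !big_ord_recr /= -IHn.
Qed.

Lemma finite_support_seq (I : choiceType) (F : I -> R) (s : seq I) :
  (forall a, a \notin s -> F a = 0) ->
  finite_set [set a | F a != 0]%classic.
Proof.
move=> Fs; apply: sub_finite_set (finite_seq s) => a /=.
by apply: contraNT => /Fs ->.
Qed.

Lemma fsbig_support_seq (I : choiceType) (F : I -> R) (s : seq I) :
  uniq s -> (forall a, a \notin s -> F a = 0) ->
  \sum_(a \in [set: I]%classic) F a = \sum_(a <- s) F a.
Proof.
move=> s_uniq Fs; rewrite [RHS]fsbig_seq //.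
apply/esym/fsbig_widen => // a /= [_].
by move/negP => /Fs.
Qed.

End Summation.

Theorem theorem2p5 (R : comUnitRingType) (k l : nat) (l_gt0 : (0 < l)%N) :
  let x : fps2 R := xvar in
  let q : fps2 R := qvar in
  let lhs (j : nat) : fps2 R :=
    x ^+ j * q ^+ (l * j + k * (j * (j - 1) %/ 2))%N / qpoch q q j in
  let rhs (mn : nat * nat) : fps2 R :=
    let: (m, n) := mn in
    x ^+ (m + n) * q ^ (Qexp k l m n)
      / (qpoch q q m * qpoch (q ^+ 2) (q ^+ 2) (n %/ 2)) in
  [/\ fps2_summable lhs, fps2_summable rhs & fps2_sum lhs = fps2_sum rhs].
Proof.
move=> x q lhs rhs.
have qU n : 1 - q ^+ n.+1 \is a GRing.unit.
  (* The symbol [(q^(n+1);q)_1] consists of the single factor [1 - q^(n+1)]. *)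
  have := qpoch_qvar_unit R 1 1 (ltn0Sn n).
  by rewrite /qpoch big_ord1 expr0 mulr1.
have lhsE N : lhs N = \sum_(m < N.+1) rhs (val m, N - m)%N.
  exact: qpochV_convolution_Qexp.
(* The pairs with [m + n <= i], the only ones whose term can reach [x^i], are listed by
   antidiagonals so that each inner sum is one [lhs N]. *)
pose P i := [seq (m, N - m)%N | N <- iota 0 i.+1, m <- iota 0 N.+1].
have P_uniq i : uniq (P i).
  apply: allpairs_uniq_dep => [|N _|]; rewrite ?iota_uniq //.
  move=> _ _ /allpairsPdep[N [m [_ + ->]]] /allpairsPdep[N' [m' [_ + ->]]].
  rewrite !mem_iota /= => mN mN' [mm' NN'].
  (* The truncated difference [N - m] determines [N] because [m <= N]. *)
  by rewrite mm'; have -> : N = N' by lia.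
have lhs0 i j n : n \notin iota 0 i.+1 -> fps2_coef (lhs n) i j = 0.
  rewrite mem_iota /= add0n ltnS -ltnNge /lhs => ?.
  by rewrite -mulrA fps2_coef_xXnM.
have rhs0 i j mn : mn \notin P i -> fps2_coef (rhs mn) i j = 0.
  case: mn => m n mnP; rewrite /rhs -mulrA fps2_coef_xXnM // ltnNge.
  apply: contra mnP => mn_i; apply/allpairsPdep; exists (m + n)%N, m.
  by rewrite !mem_iota addKn !add0n !ltnS leq_addr.
split=> [i j|i j|]; [exact: finite_support_seq (lhs0 i j)| |].
  exact: finite_support_seq (rhs0 i j).
apply: fpsP => i; apply: fpsP => j /=.
rewrite (fsbig_support_seq (iota_uniq _ _) (lhs0 i j)).
rewrite (fsbig_support_seq (P_uniq i) (rhs0 i j)) big_allpairs_dep.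
apply: eq_bigr => N _.
rewrite lhsE (fps2_coef_sum _ (fun m => rhs (m, N - m)%N)).
rewrite -(big_mkord xpredT (fun m => fps2_coef (rhs (m, N - m)%N) i j)).
by rewrite /index_iota subn0.
Qed.
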